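(* Let $V_1$, $V_2$ be complex superspaces of superdimensions $n_1|n_1$ and $n_2|n_2$. If $n_1n_2>1$, then $\mathfrak g=\mathfrak q(V_1)\odot\mathfrak q(V_2)$ is a maximal subalgebra of $\mathfrak{sl}(V_1\otimes^QV_2)$.
   Context: Let $U$ be a $1|1$-dimensional superspace and $J_U=\begin{pmatrix}0&1\\-1&0\end{pmatrix}$, $I_U=\begin{pmatrix}0&i\\i&0\end{pmatrix}\in\mathrm{End}(U)$; these odd operators supercommute and $J_U^2=I_U^2=-1$. Write $V_1=(V_1)_{\bar0}\otimes U$, $V_2=U\otimes(V_2)_{\bar0}$. For an odd operator $J$ with $J^2=-1$, $C(J)$ denotes its supercentralizer in $\mathfrak{gl}$. Realize $\mathfrak q(V_1)=C(1\otimes J_U)=\mathrm{End}((V_1)_{\bar0})\otimes\mathrm{Span}(1,I_U)$ and $\mathfrak q(V_2)=C(I_U\otimes1)=\mathrm{Span}(1,J_U)\otimes\mathrm{End}((V_2)_{\bar0})$. Put $V_1\otimes^QV_2=(V_1)_{\bar0}\otimes U\otimes(V_2)_{\bar0}$. The map $X_1+X_2\mapsto X_1\otimes1_{(V_2)_{\bar0}}+1_{(V_1)_{\bar0}}\otimes X_2$ is a representation of $\mathfrak q(V_1)\oplus\mathfrak q(V_2)$ in $V_1\otimes^QV_2$, and $\mathfrak q(V_1)\odot\mathfrak q(V_2)$ denotes its image. $\mathfrak{sl}(V)$ is the Lie superalgebra of operators with zero supertrace. Maximal means proper and not contained in a strictly larger proper Lie subsuperalgebra. *)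

(* Defs.v *)
(* MathComp, with classical sets from MathComp-Analysis; the complex numbers
   are R[i] for R : realType. *)
From HB Require Import structures.
From mathcomp Require Import all_boot all_order all_algebra.
From mathcomp Require Import boolp classical_sets reals.
From mathcomp Require Import complex mxtens.

Set Implicit Arguments.
Unset Strict Implicit.
Unset Printing Implicit Defensive.

Import Order.TTheory GRing.Theory Num.Theory.
Local Open Scope classical_set_scope.
Local Open Scope ring_scope.

(* A finite-dimensional superspace over C, written in a homogeneous basis: it
   is C^sdim, and the i-th basis vector has parity [parity i] (false = even,
   true = odd).  Its operators are the matrices in gl C V, acting on column
   vectors. *)
Record superspace := Superspace { sdim : nat; parity : 'I_sdim -> bool }.

Notation gl C V := 'M[C]_(sdim V).

Definition sprod (V W : superspace) : superspace :=
  @Superspace (sdim V * sdim W)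
    (fun k => parity (mxtens_unindex k).1 (+) parity (mxtens_unindex k).2).

Section LieSuperalgebra.
Variables (C : numClosedFieldType) (V : superspace).
Implicit Types (X Y J : gl C V) (A B L : set (gl C V)).

Definition homog (b : bool) X : gl C V :=
  \matrix_(i, j) (if parity i (+) parity j == b then X i j else 0).

(* [X, Y] = X Y - (-1)^(|X||Y|) Y X, extended bilinearly. *)
Definition superbracket X Y : gl C V :=
  \sum_(a : bool) \sum_(b : bool)
    (homog a X *m homog b Y - (-1) ^+ (a && b) *: (homog b Y *m homog a X)).

Definition supertrace X : C := \sum_i (-1) ^+ (parity i) * X i i.

Definition sl : set (gl C V) := [set X | supertrace X = 0].

Definition supercentralizer J : set (gl C V) :=
  [set X | superbracket X J = 0].

(* A linear subspace which is graded (it contains the homogeneous components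
   of its elements) and closed under the superbracket. *)
Definition lie_subsuperalgebra A : Prop :=
  [/\ A 0,
      forall (c : C) X Y, A X -> A Y -> A (c *: X + Y),
      forall b X, A X -> A (homog b X)
    & forall X Y, A X -> A Y -> A (superbracket X Y)].

Definition maximal_subsuperalgebra L A : Prop :=
  [/\ lie_subsuperalgebra A, A `<` L
    & forall B, lie_subsuperalgebra B -> A `<` B -> ~ (B `<` L)].

End LieSuperalgebra.
Arguments sl : clear implicits.

Definition U : superspace := @Superspace (1 + 1) (fun i => i == 1 :> nat).

Definition J_U (C : numClosedFieldType) : gl C U :=
  block_mx 0 1%:M (- 1%:M) 0.

Definition I_U (C : numClosedFieldType) : gl C U :=
  block_mx 0 ('i%R)%:M ('i%R)%:M 0.

(* The purely even space C^n, playing the role of the even part of a superspace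
   of superdimension n|n. *)
Definition W (n : nat) : superspace := @Superspace n (fun=> false).

Definition V1 (n1 : nat) : superspace := sprod (W n1) U.

Definition V2 (n2 : nat) : superspace := sprod U (W n2).

Definition tensQ (n1 n2 : nat) : superspace := sprod (sprod (W n1) U) (W n2).

Section Queer.
Variables (C : numClosedFieldType) (n1 n2 : nat).

Definition q1 : set (gl C (V1 n1)) :=
  supercentralizer (1%:M *t J_U C : gl C (V1 n1)).

Definition q2 : set (gl C (V2 n2)) :=
  supercentralizer (I_U C *t 1%:M : gl C (V2 n2)).

(* W n1 (x) V2 n2 is reassociated into tensQ n1 n2; no sign occurs since the
   operators are tensored with identities of purely even spaces. *)
Definition odot_rep (X : gl C (V1 n1) * gl C (V2 n2)) : gl C (tensQ n1 n2) :=
  (X.1 *t (1%:M : gl C (W n2)))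
  + castmx (mulnA _ _ _, mulnA _ _ _) ((1%:M : gl C (W n1)) *t X.2).

Definition q_odot_q : set (gl C (tensQ n1 n2)) := odot_rep @` (q1 `*` q2).

End Queer.
Arguments q1 : clear implicits.
Arguments q2 : clear implicits.
Arguments q_odot_q : clear implicits.

(* Main.v *)
Require Import Defs.
From HB Require Import structures.
From mathcomp Require Import all_boot all_order all_algebra.
From mathcomp Require Import boolp classical_sets reals.
From mathcomp Require Import complex mxtens.
From mathcomp Require Import ring.

Set Implicit Arguments.
Unset Strict Implicit.
Unset Printing Implicit Defensive.

Import Order.TTheory GRing.Theory Num.Theory.
Local Open Scope ring_scope.

(** Why the theorem holds.  Let A and B be the matrix algebras of the two even
    spaces and R = A (x) B.  The operators 1, I = I_U, J = J_U and P = IJ form a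
    basis of End(U), so every operator on the big space is uniquely
      x.1 + y.I + z.J + w.P   with x, y, z, w in R,
    whose even part is x.1 + w.P and whose supertrace is a nonzero multiple of
    tr w.  Since I^2 = J^2 = -1 and I, J anticommute, every superbracket of two
    such terms is a commutator or an anticommutator in R, put in front of 1, I,
    J or P.  Computing two supercentralizers shows that the algebra g of the
    theorem consists of the operators
      (a + b).1 + a'.I + b'.J   with a, a' in A and b, b' in B,
    where A and B are embedded in R (q_odot_qP).  From this, g is a Lie
    subsuperalgebra and lies in sl; the inclusion is strict because e.P is in sl
    for every off-diagonal matrix unit e of R.

    Let h be a Lie subsuperalgebra with g inside h inside sl, and let L be the
    space of those w in R with w.P in h.  Everything depends on whether L is
    zero.

    If L = 0, then h = g (sub_odot_of_P_slot0).  Brackets with g move any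
    element of h towards the P-component: if x.1 + w.P is in h then so are w.I
    and w.J, hence [a, w].P and [b, w].P, so w is scalar, and w = 0 because its
    trace vanishes.  If x.1 is in h then [a, [b, x]].P is in h, which forces x
    to be in A + B.  If y.I + z.J is in h, bracketing with b.J and a.I produces
    even elements with P-components -[b, y] and [a, z], so y is in A and z in B.

    If L is not zero, then h = sl (sl_sub_of_P_slot).  Here L is closed under
    commutators and under z |-> [b, b'z] and z |-> [a, a'z].  For matrix units
    with e_ij e_kl = 0 the latter operations include z |-> e_kl z e_ij, and with
    them one nonzero entry of z yields matrix units of R.  Commutators then
    provide every traceless matrix (traceless_generated).  Finally, w.P in h
    gives w.I, w.J and w.1 in h, and the identity of R occurs with 1, I and J
    already in g, so h contains sl. *)

(** * Commutators and anticommutators of matrices *)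

Definition commmx (C : pzRingType) k (a x : 'M[C]_k) : 'M[C]_k :=
  a *m x - x *m a.

Definition anticommmx (C : pzRingType) k (a x : 'M[C]_k) : 'M[C]_k :=
  a *m x + x *m a.

Lemma commmx1 (C : pzRingType) k (x : 'M[C]_k) : commmx x 1%:M = 0.
Proof. by rewrite /commmx mulmx1 mul1mx subrr. Qed.

Lemma comm1mx (C : pzRingType) k (x : 'M[C]_k) : commmx 1%:M x = 0.
Proof. by rewrite /commmx mulmx1 mul1mx subrr. Qed.

Lemma anticommmx1 (C : pzRingType) k (x : 'M[C]_k) :
  anticommmx x 1%:M = 2%:R *: x.
Proof. by rewrite /anticommmx mulmx1 mul1mx scaler_nat. Qed.

Lemma anticomm1mx (C : pzRingType) k (x : 'M[C]_k) :
  anticommmx 1%:M x = 2%:R *: x.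
Proof. by rewrite /anticommmx mulmx1 mul1mx scaler_nat. Qed.

Lemma commmx_add_anticommmx (C : pzRingType) k (x y : 'M[C]_k) :
  commmx x y + anticommmx x y = 2%:R *: (x *m y).
Proof. by rewrite addrC addrACA subrr addr0 scaler_nat. Qed.

Lemma commmxDl (C : pzRingType) k (x y z : 'M[C]_k) :
  commmx (x + y) z = commmx x z + commmx y z.
Proof. by rewrite /commmx mulmxDl mulmxDr opprD addrACA. Qed.

Lemma commmx_linear (C : comPzRingType) k (a : 'M[C]_k) : linear (commmx a).
Proof.
move=> c x y; rewrite /commmx mulmxDr mulmxDl -scalemxAl -scalemxAr.
by rewrite scalerBr opprD addrACA.
Qed.

HB.instance Definition _ (C : comPzRingType) k (a : 'M[C]_k) :=
  GRing.isLinear.Build C 'M[C]_k 'M[C]_k _ (commmx a) (@commmx_linear C k a).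

(** * The superbracket on homogeneous operators *)

Section SuperbracketTheory.
Variables (C : numClosedFieldType) (V : superspace).
Implicit Types (X Y : gl C V).

Lemma homog_linear b : linear (@homog C V b).
Proof.
move=> c X Y; apply/matrixP=> i j; rewrite !mxE.
by case: ifP => // _; rewrite mulr0 addr0.
Qed.

HB.instance Definition _ b :=
  GRing.isLinear.Build C (gl C V) (gl C V) _ (@homog C V b) (@homog_linear b).

Lemma homog_negb b X : homog b X = X -> homog (~~ b) X = 0.
Proof.
move=> hX; apply/matrixP=> i j; rewrite -hX !mxE.
by case: (_ (+) _); case: b {hX}.
Qed.

Lemma superbracketE a b X Y : homog a X = X -> homog b Y = Y ->
  superbracket X Y = X *m Y - (-1) ^+ (a && b) *: (Y *m X).
Proof.
move=> hX hY; have := homog_negb hX; have := homog_negb hY.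
rewrite /superbracket big_bool !big_bool /=.
by case: a b hX hY => [] [] /= -> -> -> ->;
  rewrite ?mul0mx ?mulmx0 ?scaler0 ?subr0 ?addr0 ?add0r.
Qed.

Lemma superbracket_linear X : linear (superbracket X).
Proof.
move=> c Y Z; rewrite /superbracket scaler_sumr -big_split.
apply: eq_bigr => a _; rewrite scaler_sumr -big_split; apply: eq_bigr => b _ /=.
rewrite linearP mulmxDl mulmxDr -!scalemxAl -!scalemxAr scalerBr !scalerDr.
by rewrite !scalerA [_ * c]mulrC opprD addrACA.
Qed.

HB.instance Definition _ X :=
  GRing.isLinear.Build C (gl C V) (gl C V) _ (superbracket X)
    (@superbracket_linear X).

Lemma superbracketDl X Y Z :
  superbracket (X + Y) Z = superbracket X Z + superbracket Y Z.
Proof.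
rewrite /superbracket -big_split.
apply: eq_bigr => a _; rewrite -big_split; apply: eq_bigr => b _ /=.
by rewrite linearD mulmxDl mulmxDr scalerDr opprD addrACA.
Qed.

End SuperbracketTheory.

(** * The basis 1, I, J, IJ of End(U) *)

Notation u0 := (lshift 1 ord0 : 'I_(1 + 1)).
Notation u1 := (rshift 1 ord0 : 'I_(1 + 1)).

Section UnitsOfU.
Variable C : numClosedFieldType.

Definition P_U : gl C U := I_U C *m J_U C.

Lemma forall_ordU (Q : 'I_(1 + 1) -> Prop) :
  Q u0 -> Q u1 -> forall i, Q i.
Proof.
move=> Q0 Q1 i; case: (splitP i) => j ji; rewrite ord1 in ji.
  by rewrite (_ : i = u0) //; apply: val_inj.
by rewrite (_ : i = u1) //; apply: val_inj.
Qed.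

Lemma P_U_block : P_U = block_mx (- 'i)%:M 0 0 'i%:M :> gl C U.
Proof.
rewrite /P_U /I_U /J_U mulmx_block !mul0mx !mulmx0 !addr0 !add0r.
by rewrite mulmxN -!scalar_mxM !mulr1 raddfN.
Qed.

Definition entries_U :=
  (block_mxEul, block_mxEur, block_mxEdl, block_mxEdr).

Lemma one_UE : ((1%:M : gl C U) u0 u0 = 1) * ((1%:M : gl C U) u0 u1 = 0) *
  ((1%:M : gl C U) u1 u0 = 0) * ((1%:M : gl C U) u1 u1 = 1).
Proof. by rewrite !mxE. Qed.

Lemma I_UE : (I_U C u0 u0 = 0) * (I_U C u0 u1 = 'i) *
  (I_U C u1 u0 = 'i) * (I_U C u1 u1 = 0).
Proof. by rewrite /I_U !entries_U !mxE. Qed.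

Lemma J_UE : (J_U C u0 u0 = 0) * (J_U C u0 u1 = 1) *
  (J_U C u1 u0 = -1) * (J_U C u1 u1 = 0).
Proof. by rewrite /J_U !entries_U !mxE. Qed.

Lemma P_UE : (P_U u0 u0 = - 'i) * (P_U u0 u1 = 0) *
  (P_U u1 u0 = 0) * (P_U u1 u1 = 'i).
Proof. by rewrite P_U_block !entries_U !mxE. Qed.

Lemma sqrI_U : I_U C *m I_U C = - 1%:M.
Proof.
rewrite /I_U mulmx_block !mul0mx !mulmx0 !addr0 !add0r.
rewrite -!scalar_mxM -expr2 sqrCi -raddfN /=.
by rewrite -[LHS](scalar_mx_block 1 1 (-1 : C)).
Qed.

Lemma sqrJ_U : J_U C *m J_U C = - 1%:M.
Proof.
rewrite /J_U mulmx_block !mul0mx !mulmx0 !addr0 !add0r mulmxN mulNmx mulmx1.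
by rewrite -[RHS]/(- (1%:M : 'M_(1 + 1))) scalar_mx_block opp_block_mx !oppr0.
Qed.

Lemma J_U_mul_I_U : J_U C *m I_U C = - P_U.
Proof.
rewrite P_U_block /I_U /J_U mulmx_block !mul0mx !mulmx0 !addr0 !add0r.
rewrite mulNmx -!scalar_mxM !mul1r opp_block_mx !oppr0.
by rewrite [(- 'i)%:M]raddfN opprK.
Qed.

Lemma P_U_mul_I_U : P_U *m I_U C = J_U C.
Proof.
rewrite /P_U -mulmxA J_U_mul_I_U mulmxN /P_U mulmxA sqrI_U.
by rewrite mulNmx opprK mul1mx.
Qed.

Lemma I_U_mul_P_U : I_U C *m P_U = - J_U C.
Proof. by rewrite /P_U mulmxA sqrI_U mulNmx mul1mx. Qed.

Lemma P_U_mul_J_U : P_U *m J_U C = - I_U C.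
Proof. by rewrite /P_U -mulmxA sqrJ_U mulmxN mulmx1. Qed.

Lemma J_U_mul_P_U : J_U C *m P_U = I_U C.
Proof. by rewrite /P_U mulmxA J_U_mul_I_U mulNmx P_U_mul_J_U opprK. Qed.

Lemma homog_1U : homog (V := U) false (1%:M : gl C U) = 1%:M.
Proof.
by apply/matrixP=> i j; elim/forall_ordU: i; elim/forall_ordU: j; rewrite !mxE.
Qed.

Lemma homog_P_U : homog false P_U = P_U.
Proof.
apply/matrixP=> i j; rewrite mxE.
by elim/forall_ordU: i; elim/forall_ordU: j; rewrite /= P_UE.
Qed.

Lemma homog_I_U : homog true (I_U C) = I_U C.
Proof.
apply/matrixP=> i j; rewrite mxE.
by elim/forall_ordU: i; elim/forall_ordU: j; rewrite /= I_UE.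
Qed.

Lemma homog_J_U : homog true (J_U C) = J_U C.
Proof.
apply/matrixP=> i j; rewrite mxE.
by elim/forall_ordU: i; elim/forall_ordU: j; rewrite /= J_UE.
Qed.

End UnitsOfU.
Arguments P_U : clear implicits.

(** * Operators on a tensor product with U *)

(** An identification of V with the tensor product of an even space of
    dimension k and U, up to a reordering of the homogeneous basis.  The modules
    of both queer algebras and their tensor product carry one, with the factor U
    at different places, and this makes one computation serve all three. *)
Record splitting (V : superspace) (k : nat) := Splitting {
  split_index :> 'I_(sdim V) -> 'I_k * 'I_(sdim U);
  split_index_bij : bijective split_index;
  split_parity : forall i, parity i = @parity U (split_index i).2 }.

Section Embedding.
Variables (C : numClosedFieldType) (V : superspace) (k : nat).
Variable f : splitting V k.
Implicit Types (m : gl C U) (x y z w : 'M[C]_k) (X : gl C V).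

(** The operator x (x) m. *)
Definition emb m x : gl C V :=
  \matrix_(i, j) (x (f i).1 (f j).1 * m (f i).2 (f j).2).

Lemma embE g m x p u q v : cancel g f ->
  emb m x (g (p, u)) (g (q, v)) = x p q * m u v.
Proof. by move=> gK; rewrite mxE !gK. Qed.

Lemma emb_linear m : linear (emb m).
Proof.
by move=> c x y; apply/matrixP=> i j; rewrite !mxE mulrDl mulrA.
Qed.

HB.instance Definition _ m :=
  GRing.isLinear.Build C 'M[C]_k (gl C V) _ (emb m) (@emb_linear m).

Lemma embNl m x : emb (- m) x = - emb m x.
Proof. by apply/matrixP=> i j; rewrite !mxE mulrN. Qed.

Lemma split_sum (g : 'I_k * 'I_(sdim U) -> 'I_(sdim V))
    (F : 'I_(sdim V) -> C) :
  cancel f g -> cancel g f -> \sum_i F i = \sum_p \sum_u F (g (p, u)).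
Proof.
move=> fK gK; rewrite pair_bigA /= (reindex g); first by apply: eq_bigr => -[].
by exists f => i _; [exact: gK | exact: fK].
Qed.

Lemma emb_mul m1 m2 x y : emb m1 x *m emb m2 y = emb (m1 *m m2) (x *m y).
Proof.
have [g fK gK] := split_index_bij f.
apply/matrixP=> i j; rewrite !mxE (split_sum _ fK gK) mulr_suml.
apply: eq_bigr => p _; rewrite mulr_sumr; apply: eq_bigr => u _.
by rewrite !mxE !gK /= mulrACA.
Qed.

Lemma homog_emb b m x : homog b (emb m x) = emb (homog b m) x.
Proof.
apply/matrixP=> i j; rewrite !mxE !(split_parity f).
by case: ifP => // _; rewrite mulr0.
Qed.

Lemma supertrace_emb m x :
  supertrace (emb m x) = \tr x * \sum_u (-1) ^+ (@parity U u) * m u u.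
Proof.
have [g fK gK] := split_index_bij f.
rewrite /supertrace (split_sum _ fK gK) mulr_suml.
apply: eq_bigr => p _; rewrite mulr_sumr; apply: eq_bigr => u _.
by rewrite !mxE (split_parity f) !gK /= mulrCA.
Qed.

(** The coefficients are read off from the four blocks X_uv of X, for u and v
    basis vectors of U, by inverting the matrices
      1 = diag(1, 1), P = diag(-i, i), I = (0, i; i, 0), J = (0, 1; -1, 0). *)
Lemma emb_decomp X : exists x y z w,
  X = emb 1%:M x + emb (I_U C) y + emb (J_U C) z + emb (P_U C) w.
Proof.
have [g fK gK] := split_index_bij f.
have ii : 'i * 'i = -1 :> C by rewrite -expr2 sqrCi.
have D (A B : gl C V) i j : (A + B) i j = A i j + B i j by rewrite mxE.
pose c u v : 'M[C]_k := \matrix_(p, q) X (g (p, u)) (g (q, v)).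
have cE a u v u' v' b p q : (a *: (c u v + b *: c u' v')) p q =
    a * (X (g (p, u)) (g (q, v)) + b * X (g (p, u')) (g (q, v'))).
  by rewrite !mxE.
exists (2%:R^-1 *: (c u0 u0 + 1 *: c u1 u1)).
exists (- 'i / 2%:R *: (c u0 u1 + 1 *: c u1 u0)).
exists (2%:R^-1 *: (c u0 u1 + (-1) *: c u1 u0)).
exists ('i / 2%:R *: (c u0 u0 + (-1) *: c u1 u1)).
apply/matrixP=> i j; rewrite !D -(fK i) -(fK j).
case: (f i) (f j) => p u [q v] /=; rewrite !embE // !cE.
by elim/forall_ordU: u; elim/forall_ordU: v;
  rewrite !(one_UE, I_UE, J_UE, P_UE); field: ii.
Qed.

Lemma emb_indep x y z w :
  emb 1%:M x + emb (I_U C) y + emb (J_U C) z + emb (P_U C) w = 0 ->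
  [/\ x = 0, y = 0, z = 0 & w = 0].
Proof.
have [g fK gK] := split_index_bij f.
have D (A B : gl C V) i j : (A + B) i j = A i j + B i j by rewrite mxE.
move=> /matrixP E0.
suff H p q : [/\ x p q = 0, y p q = 0, z p q = 0 & w p q = 0].
  by split; apply/matrixP=> p q; have [] := H p q; rewrite mxE.
have := E0 (g (p, u1)) (g (q, u1)); have := E0 (g (p, u1)) (g (q, u0)).
have := E0 (g (p, u0)) (g (q, u1)); have := E0 (g (p, u0)) (g (q, u0)).
rewrite !D !embE // !(one_UE, I_UE, J_UE, P_UE).
rewrite ![(0 : 'M[C]_(sdim V)) _ _]mxE.
rewrite !mulr0 !mulr1 !mulrN !mulr1 !addr0 !add0r.
move=> /subr0_eq -> /addr0_eq <-; rewrite opprK -!mulr2n => /eqP + /eqP.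
by rewrite !mulrn_eq0 !mulf_eq0 (negPf (neq0Ci C)) !orbF => /eqP-> /eqP->;
  rewrite mul0r oppr0.
Qed.

End Embedding.

(** * Multiplication table of the superbracket *)

Section BracketTable.
Variables (C : numClosedFieldType) (V : superspace) (k : nat).
Variable f : splitting V k.
Implicit Types (m : gl C U) (x y : 'M[C]_k) (X : gl C V).

Local Notation E0 := (emb f 1%:M).
Local Notation EI := (emb f (I_U C)).
Local Notation EJ := (emb f (J_U C)).
Local Notation EP := (emb f (P_U C)).

Lemma emb0l x : emb f 0 x = 0.
Proof. by apply/matrixP=> i j; rewrite !mxE mulr0. Qed.

Lemma homog_even_decomp x y z w :
  homog false (E0 x + EI y + EJ z + EP w) = E0 x + EP w.
Proof.
rewrite !linearD /= !homog_emb homog_1U homog_P_U.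
by rewrite !(homog_negb (homog_I_U C), homog_negb (homog_J_U C)) !emb0l !addr0.
Qed.

Lemma homog_odd_decomp x y z w :
  homog true (E0 x + EI y + EJ z + EP w) = EI y + EJ z.
Proof.
rewrite !linearD /= !homog_emb homog_I_U homog_J_U.
by rewrite !(homog_negb (homog_1U C), homog_negb (homog_P_U C)) !emb0l
  add0r addr0.
Qed.

(** Since the first tensor factor is even, signs come only from the second one,
    where the units commute or anticommute. *)
Lemma superbracket_emb a b m1 m2 x y : homog a m1 = m1 -> homog b m2 = m2 ->
  superbracket (emb f m1 x) (emb f m2 y) =
  emb f (m1 *m m2) (x *m y) - (-1) ^+ (a && b) *: emb f (m2 *m m1) (y *m x).
Proof.
move=> h1 h2; rewrite (@superbracketE _ _ a b) ?homog_emb ?h1 ?h2 //.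
by rewrite !emb_mul.
Qed.

Lemma bracket_E0 b m x y : homog b m = m ->
  superbracket (E0 x) (emb f m y) = emb f m (commmx x y).
Proof.
move=> hm; rewrite (@superbracket_emb false b) ?homog_1U //.
by rewrite scale1r mul1mx mulmx1 linearB.
Qed.

Lemma bracket_IE0 x y : superbracket (EI x) (E0 y) = EI (commmx x y).
Proof.
rewrite (@superbracket_emb true false) ?homog_1U ?homog_I_U //.
by rewrite scale1r mul1mx mulmx1 linearB.
Qed.

Lemma bracket_JE0 x y : superbracket (EJ x) (E0 y) = EJ (commmx x y).
Proof.
rewrite (@superbracket_emb true false) ?homog_1U ?homog_J_U //.
by rewrite scale1r mul1mx mulmx1 linearB.
Qed.

Lemma bracket_II x y : superbracket (EI x) (EI y) = - E0 (anticommmx x y).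
Proof.
rewrite (@superbracket_emb true true) ?homog_I_U //= sqrI_U.
by rewrite !embNl scaleN1r opprK linearD opprD.
Qed.

Lemma bracket_JJ x y : superbracket (EJ x) (EJ y) = - E0 (anticommmx x y).
Proof.
rewrite (@superbracket_emb true true) ?homog_J_U //= sqrJ_U.
by rewrite !embNl scaleN1r opprK linearD opprD.
Qed.

Lemma bracket_IJ x y : superbracket (EI x) (EJ y) = EP (commmx x y).
Proof.
rewrite (@superbracket_emb true true) ?homog_I_U ?homog_J_U //=.
by rewrite J_U_mul_I_U embNl scaleN1r opprK linearB.
Qed.

Lemma bracket_JI x y : superbracket (EJ x) (EI y) = - EP (commmx x y).
Proof.
rewrite (@superbracket_emb true true) ?homog_I_U ?homog_J_U //=.
by rewrite J_U_mul_I_U embNl scaleN1r opprK linearB opprB addrC.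
Qed.

Lemma bracket_IP x y : superbracket (EI x) (EP y) = - EJ (anticommmx x y).
Proof.
rewrite (@superbracket_emb true false) ?homog_I_U ?homog_P_U //=.
by rewrite I_U_mul_P_U P_U_mul_I_U embNl scale1r linearD opprD.
Qed.

Lemma bracket_JP x y : superbracket (EJ x) (EP y) = EI (anticommmx x y).
Proof.
rewrite (@superbracket_emb true false) ?homog_J_U ?homog_P_U //=.
by rewrite J_U_mul_P_U P_U_mul_J_U embNl scale1r opprK linearD.
Qed.

Lemma bracket_PI x y : superbracket (EP x) (EI y) = EJ (anticommmx x y).
Proof.
rewrite (@superbracket_emb false true) ?homog_I_U ?homog_P_U //=.
by rewrite I_U_mul_P_U P_U_mul_I_U embNl scale1r opprK linearD.
Qed.

Lemma bracket_PJ x y : superbracket (EP x) (EJ y) = - EI (anticommmx x y).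
Proof.
rewrite (@superbracket_emb false true) ?homog_J_U ?homog_P_U //=.
by rewrite J_U_mul_P_U P_U_mul_J_U embNl scale1r linearD opprD.
Qed.

(** This identifies the first queer algebra: bracketing with J kills x.1 and
    y.I, and sends z.J to -2z.1 and w.P to -2w.I. *)
Lemma supercentralizer_J X :
  supercentralizer (EJ 1%:M) X <-> exists x y, X = E0 x + EI y.
Proof.
have J1 x y z w : superbracket (E0 x + EI y + EJ z + EP w) (EJ 1%:M) =
    E0 (- 2%:R *: z) + EI (- 2%:R *: w) + EJ 0 + EP 0.
  rewrite !superbracketDl (bracket_E0 _ _ (homog_J_U C)).
  rewrite bracket_IJ bracket_JJ bracket_PJ !commmx1 !anticommmx1.
  by rewrite !scaleNr !linearN !linear0 !add0r !addr0.
split=> [|[x [y ->]]]; last first.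
  have := J1 x y 0 0; rewrite /supercentralizer /= !scaler0 !linear0 !addr0.
  exact.
have [x [y [z [w ->]]]] := emb_decomp f X.
rewrite /supercentralizer /= J1 => /emb_indep[/eqP + /eqP + _ _].
rewrite !scaler_eq0 oppr_eq0 pnatr_eq0 /= => /eqP-> /eqP->.
by exists x, y; rewrite !linear0 !addr0.
Qed.

Lemma supercentralizer_I X :
  supercentralizer (EI 1%:M) X <-> exists x z, X = E0 x + EJ z.
Proof.
have I1 x y z w : superbracket (E0 x + EI y + EJ z + EP w) (EI 1%:M) =
    E0 (- 2%:R *: y) + EI 0 + EJ (2%:R *: w) + EP 0.
  rewrite !superbracketDl (bracket_E0 _ _ (homog_I_U C)).
  rewrite bracket_II bracket_JI bracket_PI !commmx1 !anticommmx1.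
  by rewrite scaleNr !linearN !linear0 sub0r !addr0.
split=> [|[x [z ->]]]; last first.
  have := I1 x 0 z 0; rewrite /supercentralizer /= !scaler0 !linear0 !addr0.
  exact.
have [x [y [z [w ->]]]] := emb_decomp f X.
rewrite /supercentralizer /= I1 => /emb_indep[/eqP + _ /eqP + _].
rewrite !scaler_eq0 oppr_eq0 pnatr_eq0 /= => /eqP-> /eqP->.
by exists x, z; rewrite !linear0 !addr0.
Qed.

End BracketTable.

(** * The two commuting factors of a matrix algebra *)

Section DeltaSums.
Variable C : pzRingType.

Lemma sum_delta_l n (i : 'I_n) (F : 'I_n -> C) :
  \sum_j (i == j)%:R * F j = F i.
Proof.
rewrite (bigD1 i) //= eqxx mul1r big1 ?addr0 // => j /negPf.
by rewrite eq_sym => ->; rewrite mul0r.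
Qed.

Lemma sum_delta_r n (i : 'I_n) (F : 'I_n -> C) :
  \sum_j F j * (j == i)%:R = F i.
Proof.
rewrite -[RHS](sum_delta_l i); apply: eq_bigr => j _.
by rewrite mulr_natl mulr_natr eq_sym.
Qed.

End DeltaSums.

Section TensorFactors.
Variables (C : numClosedFieldType) (n1 n2 : nat).
Implicit Types (a : 'M[C]_n1) (b : 'M[C]_n2) (x y z : 'M[C]_(n1 * n2)).

Definition tensl a : 'M[C]_(n1 * n2) := a *t 1%:M.
Definition tensr b : 'M[C]_(n1 * n2) := 1%:M *t b.

Lemma tensl_linear : linear tensl.
Proof.
by move=> c a a'; apply/matrixP=> i j; rewrite !mxE mulrDl mulrA.
Qed.

Lemma tensr_linear : linear tensr.
Proof.
by move=> c b b'; apply/matrixP=> i j; rewrite !mxE mulrDr mulrCA.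
Qed.

HB.instance Definition _ :=
  GRing.isLinear.Build C 'M[C]_n1 'M[C]_(n1 * n2) _ tensl tensl_linear.
HB.instance Definition _ :=
  GRing.isLinear.Build C 'M[C]_n2 'M[C]_(n1 * n2) _ tensr tensr_linear.

Lemma tenslM a a' : tensl a *m tensl a' = tensl (a *m a').
Proof. by rewrite /tensl tensmx_mul mulmx1. Qed.

Lemma tensrM b b' : tensr b *m tensr b' = tensr (b *m b').
Proof. by rewrite /tensr tensmx_mul mulmx1. Qed.

Lemma tensl_tensrC a b : tensl a *m tensr b = tensr b *m tensl a.
Proof. by rewrite /tensl /tensr !tensmx_mul !mul1mx !mulmx1. Qed.

Lemma commmx_tensl a a' :
  commmx (tensl a) (tensl a') = tensl (commmx a a').
Proof. by rewrite /commmx !tenslM -linearB. Qed.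

Lemma commmx_tensr b b' :
  commmx (tensr b) (tensr b') = tensr (commmx b b').
Proof. by rewrite /commmx !tensrM -linearB. Qed.

Lemma mxtens_index_eq (p q : 'I_n1) (k l : 'I_n2) :
  (mxtens_index (p, k) == mxtens_index (q, l)) = (p == q) && (k == l).
Proof. by rewrite (can_eq (@mxtens_indexK _ _)) xpair_eqE. Qed.

Lemma tens_delta p q k l : tensl (delta_mx p q) *m tensr (delta_mx k l) =
  delta_mx (mxtens_index (p, k)) (mxtens_index (q, l)).
Proof.
rewrite tensmx_mul mulmx1 mul1mx; apply/matrixP=> i j.
case: (mxtens_indexP i) => p' k'; case: (mxtens_indexP j) => q' l'.
by rewrite tensmxE !mxE !mxtens_index_eq -natrM mulnb andbACA.
Qed.

Lemma tensl1 : tensl 1%:M = 1%:M.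
Proof.
apply/matrixP=> i j.
case: (mxtens_indexP i) => p k; case: (mxtens_indexP j) => q l.
by rewrite tensmxE !mxE !mxtens_index_eq -natrM mulnb.
Qed.

Lemma tensr1 : tensr 1%:M = 1%:M. Proof. exact: tensl1. Qed.

Lemma sum_mxtens (F : 'I_(n1 * n2) -> C) :
  \sum_i F i = \sum_p \sum_k F (mxtens_index (p, k)).
Proof.
rewrite pair_bigA /= (reindex (@mxtens_index n1 n2)).
  by apply: eq_bigr => -[].
exists (@mxtens_unindex n1 n2) => i _;
  [exact: mxtens_indexK | exact: mxtens_unindexK].
Qed.

Lemma tensl_mulE a x p k j : (tensl a *m x) (mxtens_index (p, k)) j =
  \sum_q a p q * x (mxtens_index (q, k)) j.
Proof.
rewrite mxE sum_mxtens; apply: eq_bigr => q _.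
rewrite -(sum_delta_l k (fun l => a p q * x (mxtens_index (q, l)) j)).
by apply: eq_bigr => l _; rewrite tensmxE mxE mulrCA mulrA.
Qed.

Lemma tensr_mulE b x p k j : (tensr b *m x) (mxtens_index (p, k)) j =
  \sum_l b k l * x (mxtens_index (p, l)) j.
Proof.
rewrite mxE sum_mxtens exchange_big; apply: eq_bigr => l _.
rewrite -(sum_delta_l p (fun q => b k l * x (mxtens_index (q, l)) j)).
by apply: eq_bigr => q _; rewrite tensmxE mxE mulrA.
Qed.

Lemma mul_tenslE a x i p k : (x *m tensl a) i (mxtens_index (p, k)) =
  \sum_q x i (mxtens_index (q, k)) * a q p.
Proof.
rewrite mxE sum_mxtens; apply: eq_bigr => q _.
rewrite -(sum_delta_r k (fun l => x i (mxtens_index (q, l)) * a q p)).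
by apply: eq_bigr => l _; rewrite tensmxE mxE mulrA.
Qed.

Lemma mul_tensrE b x i p k : (x *m tensr b) i (mxtens_index (p, k)) =
  \sum_l x i (mxtens_index (p, l)) * b l k.
Proof.
rewrite mxE sum_mxtens exchange_big; apply: eq_bigr => l _.
rewrite -(sum_delta_r p (fun q => x i (mxtens_index (q, l)) * b l k)).
by apply: eq_bigr => q _; rewrite tensmxE mxE mulrA mulrAC.
Qed.

(** Comparing entries in the commutation with the matrix unit e_(k0, k) of the
    second factor shows that all the blocks of x vanish off the diagonal and
    agree on it. *)
Lemma centralizer_tensr x : (0 < n2)%N ->
  (forall b, commmx (tensr b) x = 0) -> exists a, x = tensl a.
Proof.
move=> n2_gt0 cx; pose k0 := Ordinal n2_gt0.
exists (\matrix_(p, q) x (mxtens_index (p, k0)) (mxtens_index (q, k0))).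
apply/matrixP=> i j.
case: (mxtens_indexP i) => p k; case: (mxtens_indexP j) => q l.
have /matrixP/(_ (mxtens_index (p, k0)) (mxtens_index (q, l))) :=
  subr0_eq (cx (delta_mx k0 k)).
rewrite tensr_mulE mul_tensrE tensmxE 2!mxE => E.
transitivity (\sum_l0 delta_mx k0 k k0 l0 *
    x (mxtens_index (p, l0)) (mxtens_index (q, l))).
  rewrite -(sum_delta_l k (fun m => x (mxtens_index (p, m)) _)).
  by apply: eq_bigr => m _; rewrite mxE eqxx eq_sym.
rewrite E -(sum_delta_r k0 (fun m =>
  x (mxtens_index (p, k0)) (mxtens_index (q, m)) * (k == l)%:R)).
apply: eq_bigr => m _; rewrite mxE [l == k]eq_sym -mulrA -natrM mulnb.
by rewrite [in RHS]andbC.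
Qed.

Lemma centralizer_tensl x : (0 < n1)%N ->
  (forall a, commmx (tensl a) x = 0) -> exists b, x = tensr b.
Proof.
move=> n1_gt0 cx; pose p0 := Ordinal n1_gt0.
exists (\matrix_(k, l) x (mxtens_index (p0, k)) (mxtens_index (p0, l))).
apply/matrixP=> i j.
case: (mxtens_indexP i) => p k; case: (mxtens_indexP j) => q l.
have /matrixP/(_ (mxtens_index (p0, k)) (mxtens_index (q, l))) :=
  subr0_eq (cx (delta_mx p0 p)).
rewrite tensl_mulE mul_tenslE tensmxE 2!mxE => E.
transitivity (\sum_q0 delta_mx p0 p p0 q0 *
    x (mxtens_index (q0, k)) (mxtens_index (q, l))).
  rewrite -(sum_delta_l p (fun m => x (mxtens_index (m, k)) _)).
  by apply: eq_bigr => m _; rewrite mxE eqxx eq_sym.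
rewrite E mulrC -(sum_delta_r p0 (fun m =>
  x (mxtens_index (p0, k)) (mxtens_index (m, l)) * (p == q)%:R)).
apply: eq_bigr => m _; rewrite mxE [q == p]eq_sym -mulrA -natrM mulnb.
by rewrite [in RHS]andbC.
Qed.

Lemma centralizer_tensl_tensr x : (0 < n1)%N -> (0 < n2)%N ->
  (forall a, commmx (tensl a) x = 0) -> (forall b, commmx (tensr b) x = 0) ->
  is_scalar_mx x.
Proof.
move=> n1_gt0 n2_gt0 /(centralizer_tensl n1_gt0)[b xb].
move=> /(centralizer_tensr n2_gt0)[a xa].
pose p0 := Ordinal n1_gt0; pose k0 := Ordinal n2_gt0.
have E p k q l : a p q * (k == l)%:R = (p == q)%:R * b k l.
  have /matrixP/(_ (mxtens_index (p, k)) (mxtens_index (q, l))) :=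
    etrans (esym xa) xb.
  by rewrite !tensmxE !mxE.
have ap p : a p p = a p0 p0.
  by have := E p k0 p k0; have := E p0 k0 p0 k0; rewrite !eqxx !mulr1 => <-.
apply/is_scalar_mxP; exists (a p0 p0); rewrite xa; apply/matrixP=> i j.
case: (mxtens_indexP i) => p k; case: (mxtens_indexP j) => q l.
rewrite tensmxE !mxE mxtens_index_eq.
have [<-|pq] /= := eqVneq p q; first by rewrite ap mulr_natr.
by rewrite E (negPf pq) mul0r.
Qed.

(** Let beta(x) be the block of x at a fixed diagonal place of the first
    factor.  For every b, [b, x] commutes with the first factor, so it is some
    b' in the second; applying beta, which commutes with ad b, shows
    b' = [b, beta(x)].  Hence x - beta(x) commutes with the second factor. *)
Lemma double_centralizer x : (0 < n1)%N -> (0 < n2)%N ->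
  (forall a b, commmx (tensl a) (commmx (tensr b) x) = 0) ->
  exists a b, x = tensl a + tensr b.
Proof.
move=> n1_gt0 n2_gt0 cx; pose p0 := Ordinal n1_gt0.
pose beta y : 'M_n2 :=
  \matrix_(k, l) y (mxtens_index (p0, k)) (mxtens_index (p0, l)).
have betar b : beta (tensr b) = b.
  by apply/matrixP=> k l; rewrite mxE tensmxE mxE eqxx mul1r.
have betac b y : beta (commmx (tensr b) y) = commmx b (beta y).
  have E n (A B : 'M[C]_n) i j :
      commmx A B i j = (A *m B) i j - (B *m A) i j by rewrite !mxE.
  apply/matrixP=> k l; rewrite mxE !E tensr_mulE mul_tensrE !mxE.
  by congr (_ - _); apply: eq_bigr => m _; rewrite mxE.
have [a xa] : exists a, x - tensr (beta x) = tensl a.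
  apply: centralizer_tensr => // b.
  have [b' Eb] := centralizer_tensl n1_gt0 (cx^~ b).
  have /(congr1 beta) := Eb; rewrite betac betar => Eb'.
  by rewrite linearB /= Eb -Eb' commmx_tensr subrr.
by exists a, (beta x); rewrite -xa subrK.
Qed.

End TensorFactors.

(** * Generating all traceless matrices *)

Section Generation.
Variables (C : numClosedFieldType).

Record linear_subspace n (L : 'M[C]_n -> Prop) : Prop := LinearSubspace {
  subspace0 : L 0;
  subspaceP : forall c x y, L x -> L y -> L (c *: x + y) }.

Section Closure.
Variables (n : nat) (L : 'M[C]_n -> Prop) (Lsub : linear_subspace L).

Lemma subspaceD x y : L x -> L y -> L (x + y).
Proof. by move=> Lx Ly; rewrite -[x]scale1r; apply: subspaceP. Qed.

Lemma subspaceZ c x : L x -> L (c *: x).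
Proof.
move=> Lx; rewrite -[_ *: _]addr0.
by apply: subspaceP => //; apply: subspace0.
Qed.

Lemma subspaceZ_inv c x : c != 0 -> L (c *: x) -> L x.
Proof. by move=> c0 /(subspaceZ c^-1); rewrite scalerA mulVf // scale1r. Qed.

Lemma subspaceN_inv x : L (- x) -> L x.
Proof. by move=> /(subspaceZ (-1)); rewrite scaleN1r opprK. Qed.

Lemma subspace_sum (I : finType) (Q : pred I) (F : I -> 'M[C]_n) :
  (forall i, Q i -> L (F i)) -> L (\sum_(i | Q i) F i).
Proof.
by move=> LF; apply: big_ind => //; [exact: subspace0 | exact: subspaceD].
Qed.

Hypothesis lieL : forall x y, L x -> L y -> L (commmx x y).

(** The diagonal differences e_ii - e_00 are the commutators [e_i0, e_0i]. *)
Lemma traceless_of_offdiag x :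
  (forall i j : 'I_n, i != j -> L (delta_mx i j)) -> \tr x = 0 -> L x.
Proof.
move=> Loff trx.
have [n_gt0|] := ltnP 0 n; last first.
  move=> n0; have -> : x = 0.
    by apply/matrixP=> i; have := leq_trans (ltn_ord i) n0.
  exact: subspace0.
pose i0 := Ordinal n_gt0.
have Ldiag i : L (delta_mx i i - delta_mx i0 i0).
  have [->|ii0] := eqVneq i i0; first by rewrite subrr; apply: subspace0.
  have := lieL (Loff _ _ ii0) (Loff i0 i _).
  by rewrite /commmx !mul_delta_mx; apply; rewrite eq_sym.
have -> : x = \sum_i (\sum_j x i j *: delta_mx i j - x i i *: delta_mx i0 i0).
  by rewrite sumrB -scaler_suml -/(mxtrace x) trx scale0r subr0
    -matrix_sum_delta.
apply: subspace_sum => i _.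
rewrite (bigD1 i) //= addrAC -scalerBr.
apply: subspaceD; first exact: subspaceZ.
by apply: subspace_sum => j ji; apply/subspaceZ/Loff; rewrite eq_sym.
Qed.

(** The identity behind this lemma is
      [[s, s't], st'] + [t, st'] = 2 stt'.
    It is applied with s, s' transposed matrix units of one factor of a tensor
    product and t, t' transposed matrix units of the other.  The maps
    z |-> [a, a'z] and z |-> [b, b'z] preserve the vanishing of both partial
    traces of z, so elements with a nonzero partial trace have to come from a
    bracket of two elements of L. *)
Lemma product_of_factors (s s' t t' : 'M[C]_n) :
  s *m t = t *m s -> s *m t' = t' *m s -> s' *m t = t *m s' ->
  s' *m t' = t' *m s' -> s *m s = 0 -> s *m s' *m s = s ->
  (forall x, L x -> L (commmx s x)) -> (forall x, L x -> L (commmx t x)) ->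
  L (s' *m t) -> L (s *m t') -> L (s *m (t *m t')).
Proof.
move=> st st' s't s't' ss ss's adsL adtL Ls't Lst'.
have E : commmx (commmx s (s' *m t)) (s *m t') + commmx t (s *m t') =
    2%:R *: (s *m (t *m t')).
  have e1 : s *m (s' *m t) *m (s *m t') = s *m (t *m t').
    by rewrite -!mulmxA (mulmxA t s) -st -!mulmxA !mulmxA ss's.
  have e2 : s' *m t *m s *m (s *m t') = 0.
    by rewrite -!mulmxA (mulmxA s s) ss mul0mx !mulmx0.
  have e3 : s *m t' *m (s *m (s' *m t)) = 0.
    by rewrite st' -!mulmxA (mulmxA s s) ss mul0mx !mulmx0.
  have e4 : s *m t' *m (s' *m t *m s) = s *m (t' *m t).
    by rewrite -!mulmxA -st (mulmxA t' s') -s't' -!mulmxA (mulmxA t' s) -st'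
      !mulmxA ss's.
  have e5 : t *m (s *m t') = s *m (t *m t') by rewrite mulmxA -st mulmxA.
  have e6 : s *m t' *m t = s *m (t' *m t) by rewrite mulmxA.
  rewrite /commmx mulmxBl mulmxBr e1 e2 e3 e4 e5 e6.
  by rewrite subr0 sub0r opprK addrACA subrr addr0 scaler_nat.
apply: (@subspaceZ_inv 2%:R); first by rewrite pnatr_eq0.
by rewrite -E; apply: subspaceD; [apply: lieL => //; apply: adsL | apply: adtL].
Qed.

End Closure.

Lemma mul_delta_mid n (z : 'M[C]_n) (i j k l : 'I_n) :
  delta_mx i j *m z *m delta_mx k l = z j k *: delta_mx i l.
Proof.
apply/matrixP=> u v; rewrite mxE (bigD1 k) //= big1 ?addr0; last first.
  by move=> m mk; rewrite [delta_mx k l _ _]mxE (negPf mk) mulr0.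
rewrite mxE (bigD1 j) //= big1 ?addr0; last first.
  by move=> m mj; rewrite mxE (negPf mj) andbF mul0r.
by rewrite !mxE !eqxx andbT /= mulrAC -natrM mulnb mulrC.
Qed.

(** If e_kl e_ij = 0 then [e_kl, e_ij z] = - e_ij z e_kl. *)
Lemma sandwich_mem m n (L : 'M[C]_n -> Prop) (emb : 'M[C]_m -> 'M[C]_n) :
    linear_subspace L -> emb 0 = 0 -> {morph emb : a a' / a *m a'} ->
    (forall a a' z, L z -> L (commmx (emb a) (emb a' *m z))) ->
  forall i j k l z, i != l -> L z ->
    L (emb (delta_mx i j) *m z *m emb (delta_mx k l)).
Proof.
move=> Lsub emb0 embM closed i j k l z il Lz.
have := closed (delta_mx k l) (delta_mx i j) z Lz.
rewrite /commmx mulmxA -embM mul_delta_mx_0 1?eq_sym // emb0 mul0mx sub0r.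
exact: subspaceN_inv.
Qed.

(** A nonzero entry of z is isolated by sandwiching z between matrix units.
    This reaches the matrix units of the tensor product that are off-diagonal in
    each factor of size at least 2.  Those that are diagonal in one such factor
    are obtained from product_of_factors. *)
Lemma traceless_generated n1 n2 (L : 'M[C]_(n1 * n2) -> Prop) z :
    linear_subspace L ->
    (forall x y, L x -> L y -> L (commmx x y)) ->
    (forall a a' x, L x -> L (commmx (tensl n2 a) (tensl n2 a' *m x))) ->
    (forall b b' x, L x -> L (commmx (tensr n1 b) (tensr n1 b' *m x))) ->
    L z -> z != 0 ->
  forall x, \tr x = 0 -> L x.
Proof.
move=> Lsub lieL closl closr Lz z0 x; apply: traceless_of_offdiag => // {x}.
have [c [i0 [j0 [<- c0]]]] : exists c i j, z i j = c /\ c != 0.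
  have /existsP[i /existsP[j zij]] : [exists i, [exists j, z i j != 0]].
    apply: contraNT z0 => /existsPn h; apply/eqP/matrixP=> i j.
    by rewrite mxE; have /existsPn/(_ j) := h i; rewrite negbK => /eqP.
  by exists (z i j), i, j.
case: (mxtens_indexP i0) c0 => p0 k0; case: (mxtens_indexP j0) => q0 l0 c0.
have sandl := sandwich_mem Lsub (linear0 _)
  (fun a a' => esym (tenslM n2 a a')) closl.
have sandr := sandwich_mem Lsub (linear0 _)
  (fun b b' => esym (tensrM n1 b b')) closr.
have adl a y : L y -> L (commmx (tensl n2 a) y).
  by move=> Ly; have := closl a 1%:M y Ly; rewrite tensl1 mul1mx.
have adr b y : L y -> L (commmx (tensr n1 b) y).
  by move=> Ly; have := closr b 1%:M y Ly; rewrite tensr1 mul1mx.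
pose idx (p : 'I_n1) (k : 'I_n2) := mxtens_index (p, k).
have reassoc (A B D E : 'M[C]_(n1 * n2)) :
  A *m B *m z *m (D *m E) = A *m (B *m z *m D) *m E by rewrite !mulmxA.
have mixed p q k l : p != q -> k != l -> L (delta_mx (idx p k) (idx q l)).
  move=> pq kl; apply: (subspaceZ_inv Lsub c0).
  rewrite -mul_delta_mid -tens_delta -[delta_mx _ (idx q l)]tens_delta.
  rewrite [X in _ *m X]tensl_tensrC reassoc.
  by apply: sandl => //; apply: sandr.
(* In a factor of size 1 the identity itself is a matrix unit, so nothing has
   to be done on that side. *)
have one_delta n (i j : 'I_n) : n = 1%N -> 1%:M = delta_mx i j :> 'M[C]_n.
  move=> n1E; subst n; apply/matrixP=> i' j'.
  by rewrite !mxE !ord1.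
have exists_neq n (i : 'I_n) : n = 1%N \/ exists j, i != j.
  have [j ij|none] := pickP (fun j => i != j); first by right; exists j.
  left; rewrite -[n]card_ord; apply: (@eq_card1 _ i) => j.
  by rewrite !inE eq_sym; have /negbFE -> := none j.
have rowside p k l : k != l -> L (delta_mx (idx p k) (idx p l)).
  move=> kl; have [n1E|[q pq]] := exists_neq _ p.
    apply: (subspaceZ_inv Lsub c0).
    rewrite -mul_delta_mid -tens_delta -[delta_mx _ (idx p l)]tens_delta.
    rewrite -(one_delta n1 p) // -(one_delta n1 q0) // tensl1 !mul1mx.
    exact: sandr.
  rewrite -tens_delta tensl_tensrC.
  rewrite -[delta_mx p p](mul_delta_mx q) -tenslM.
  apply: (@product_of_factors _ L Lsub lieL _ (tensr n1 (delta_mx l k)));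
    rewrite ?tensl_tensrC ?tensrM ?mul_delta_mx ?mul_delta_mx_0 1?eq_sym
      ?linear0 //; try by [exact: adr | exact: adl].
  - by rewrite -tensl_tensrC tens_delta; apply: mixed; rewrite // eq_sym.
  - by rewrite -tensl_tensrC tens_delta; apply: mixed; rewrite // eq_sym.
have colside p q k : p != q -> L (delta_mx (idx p k) (idx q k)).
  move=> pq; have [n2E|[l kl]] := exists_neq _ k.
    apply: (subspaceZ_inv Lsub c0).
    rewrite -mul_delta_mid -tens_delta -[delta_mx _ (idx q k)]tens_delta.
    rewrite -(one_delta n2 k) // -(one_delta n2 l0) // tensr1 !mulmx1.
    exact: sandl.
  rewrite -tens_delta.
  rewrite -[delta_mx k k](mul_delta_mx l) -tensrM.
  apply: (@product_of_factors _ L Lsub lieL _ (tensl n2 (delta_mx q p)));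
    rewrite ?tensl_tensrC ?tenslM ?mul_delta_mx ?mul_delta_mx_0 1?eq_sym
      ?linear0 //; try by [exact: adr | exact: adl].
  - by rewrite -tensl_tensrC tens_delta; apply: mixed; rewrite // eq_sym.
  - by rewrite -tensl_tensrC tens_delta; apply: mixed; rewrite // eq_sym.
move=> i j; case: (mxtens_indexP i) => p k; case: (mxtens_indexP j) => q l.
rewrite mxtens_index_eq negb_and.
have [<-|pq] /= := eqVneq p q; first exact: rowside.
by have [<-|kl] := eqVneq k l => _; [apply: colside | apply: mixed].
Qed.

End Generation.

(** * The block form of the algebra of the theorem *)

Section Splittings.
Variables (C : numClosedFieldType) (n1 n2 : nat).

Fact V1_split_bij : bijective (@mxtens_unindex n1 (1 + 1)).
Proof.
by exists (@mxtens_index n1 (1 + 1));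
  [exact: mxtens_unindexK | exact: mxtens_indexK].
Qed.

Definition V1_split : splitting (V1 n1) n1 :=
  @Splitting (V1 n1) n1 _ V1_split_bij (fun=> erefl).

Definition V2_index (i : 'I_((1 + 1) * n2)) :=
  let p := mxtens_unindex i in (p.2, p.1).

Fact V2_split_bij : bijective V2_index.
Proof.
exists (fun p => mxtens_index (p.2, p.1)) => [i|[p u]].
  by case: (mxtens_indexP i) => u p; rewrite /V2_index !mxtens_indexK.
by rewrite /V2_index mxtens_indexK.
Qed.

Fact V2_split_parity i : @parity (V2 n2) i = @parity U (V2_index i).2.
Proof. by rewrite /= addbF. Qed.

Definition V2_split : splitting (V2 n2) n2 :=
  @Splitting (V2 n2) n2 _ V2_split_bij V2_split_parity.

Definition tensQ_index (i : 'I_(n1 * (1 + 1) * n2)) :=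
  let p := mxtens_unindex i in let q := mxtens_unindex p.1 in
  (mxtens_index (q.1, p.2), q.2).

Fact tensQ_split_bij : bijective tensQ_index.
Proof.
exists (fun p : 'I_(n1 * n2) * 'I_(1 + 1) => let q := mxtens_unindex p.1 in
  mxtens_index (mxtens_index (q.1, p.2), q.2)) => [i|[p u]].
  case: (mxtens_indexP i) => j l; case: (mxtens_indexP j) => p u.
  by rewrite /tensQ_index !mxtens_indexK.
case: (mxtens_indexP p) => j l.
by rewrite /tensQ_index !mxtens_indexK.
Qed.

Fact tensQ_split_parity i :
  @parity (tensQ n1 n2) i = @parity U (tensQ_index i).2.
Proof. by rewrite /= addbF. Qed.

Definition tensQ_split : splitting (tensQ n1 n2) (n1 * n2) :=
  @Splitting (tensQ n1 n2) _ _ tensQ_split_bij tensQ_split_parity.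

Lemma V1_J : (1%:M *t J_U C : gl C (V1 n1)) = emb V1_split (J_U C) 1%:M.
Proof. by []. Qed.

Lemma V2_I : (I_U C *t 1%:M : gl C (V2 n2)) = emb V2_split (I_U C) 1%:M.
Proof. by apply/matrixP=> i j; rewrite mxE [RHS]mxE mulrC. Qed.

Lemma emb_tens1 m (a : 'M[C]_n1) :
  (emb V1_split m a *t (1%:M : 'M_n2)) =
  emb tensQ_split m (tensl n2 a).
Proof.
apply/matrixP=> i j; rewrite mxE mxE [RHS]mxE /tensl /tensQ_split /= tensmxE.
by rewrite mulrAC.
Qed.

Lemma V2_splitE u (l : 'I_n2) : V2_split (mxtens_index (u, l)) = (l, u).
Proof. by rewrite [LHS]/= /V2_index mxtens_indexK. Qed.

Lemma tensQ_splitE (p : 'I_n1) u (l : 'I_n2) :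
  tensQ_split (mxtens_index (mxtens_index (p, u), l)) =
  (mxtens_index (p, l), u).
Proof. by rewrite [LHS]/= /tensQ_index !mxtens_indexK. Qed.

(** Reassociating the index of W (x) (U (x) W') is the identity on the
    underlying integers: (p(1+1) + u) n2 + l = p((1+1) n2) + (u n2 + l). *)
Lemma tens1_emb m (b : 'M[C]_n2) :
  castmx (mulnA _ _ _, mulnA _ _ _) ((1%:M : 'M[C]_n1) *t emb V2_split m b) =
  emb tensQ_split m (tensr n1 b) :> 'M_(n1 * (1 + 1) * n2).
Proof.
apply/matrixP=> i j; rewrite castmxE [RHS]mxE.
case: (mxtens_indexP i) => i' l; case: (mxtens_indexP i') => p u {i i'}.
case: (mxtens_indexP j) => j' l'; case: (mxtens_indexP j') => p' u' {j j'}.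
have E (q : 'I_n1) (v : 'I_(1 + 1)) (r : 'I_n2) :
    cast_ord (esym (mulnA n1 (1 + 1) n2))
      (mxtens_index (mxtens_index (q, v), r)) =
    mxtens_index (q, mxtens_index (v, r)).
  by apply: val_inj; rewrite /= mulnDl -mulnA addnA.
by rewrite !E /tensr !tensQ_splitE !tensmxE
  [emb V2_split _ _ _ _]mxE !V2_splitE mulrA.
Qed.

Local Notation E0 := (emb tensQ_split 1%:M).
Local Notation EI := (emb tensQ_split (I_U C)).
Local Notation EJ := (emb tensQ_split (J_U C)).
Local Notation EP := (emb tensQ_split (P_U C)).

Lemma q_odot_qP (X : gl C (tensQ n1 n2)) : q_odot_q C n1 n2 X <->
  exists a a' b b', X = E0 (tensl n2 a + tensr n1 b) +
    EI (tensl n2 a') + EJ (tensr n1 b').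
Proof.
have tensDl (A B : 'M[C]_(n1 * (1 + 1))) :
    (A + B) *t (1%:M : 'M_n2) = A *t 1%:M + B *t 1%:M.
  by apply/matrixP=> i j; rewrite !mxE mulrDl.
have tensDr (A B : 'M[C]_((1 + 1) * n2)) :
    (1%:M : 'M_n1) *t (A + B) = 1%:M *t A + 1%:M *t B.
  by apply/matrixP=> i j; rewrite !mxE mulrDr.
have castD m m' (e : m = m') (A B : 'M[C]_m) :
    castmx (e, e) (A + B) = castmx (e, e) A + castmx (e, e) B.
  by case: m' / e.
have repE a a' b b' :
    odot_rep (emb V1_split 1%:M a + emb V1_split (I_U C) a',
              emb V2_split 1%:M b + emb V2_split (J_U C) b') =
    E0 (tensl n2 a + tensr n1 b) + EI (tensl n2 a') + EJ (tensr n1 b').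
  rewrite /odot_rep [fst _]/= [snd _]/= tensDl tensDr castD.
  rewrite !emb_tens1 !tens1_emb.
  by rewrite linearD /= -!addrA; congr (_ + _); rewrite addrCA.
split=> [[[X1 X2] /= [q1X1 q2X2] <-]|[a [a' [b [b' ->]]]]].
  move: q1X1 q2X2; rewrite /q1 /q2 V1_J V2_I.
  move=> /supercentralizer_J[a [a' ->]] /supercentralizer_I[b [b' ->]].
  by exists a, a', b, b'; rewrite repE.
rewrite -repE.
exists (emb V1_split 1%:M a + emb V1_split (I_U C) a',
        emb V2_split 1%:M b + emb V2_split (J_U C) b') => //.
split; rewrite /= /q1 /q2 ?V1_J ?V2_I.
  by apply/supercentralizer_J; exists a, a'.
by apply/supercentralizer_I; exists b, b'.
Qed.

End Splittings.

(** * Intermediate subalgebras *)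

Section Odot.
Variables (C : numClosedFieldType) (n1 n2 : nat).
Let f := tensQ_split n1 n2.
Implicit Types (a : 'M[C]_n1) (b : 'M[C]_n2) (x y z w : 'M[C]_(n1 * n2)).
Implicit Types (X : gl C (tensQ n1 n2)) (B : set (gl C (tensQ n1 n2))).

Local Notation E0 := (emb f 1%:M).
Local Notation EI := (emb f (I_U C)).
Local Notation EJ := (emb f (J_U C)).
Local Notation EP := (emb f (P_U C)).
Local Notation g := (q_odot_q C n1 n2).

Lemma supertrace_decomp x y z w :
  supertrace (E0 x + EI y + EJ z + EP w) = - (2%:R * 'i) * \tr w.
Proof.
have strD (X Y : gl C (tensQ n1 n2)) :
    supertrace (X + Y) = supertrace X + supertrace Y.
  by rewrite -big_split; apply: eq_bigr => i _; rewrite mxE mulrDr.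
rewrite !strD !supertrace_emb !big_split_ord !big_ord1.
rewrite !(one_UE, I_UE, J_UE, P_UE) /= expr0 expr1.
by ring.
Qed.

(** The two factors commute, so the brackets that could leave g, namely those of
    a.I with b.J (which land in R.P), of a.1 with b.J and of b.1 with a.I, all
    vanish. *)
Lemma odot_lie_subsuperalgebra : lie_subsuperalgebra g.
Proof.
have clr a b : commmx (tensl n2 a) (tensr n1 b) = 0.
  by rewrite /commmx tensl_tensrC subrr.
have crl a b : commmx (tensr n1 b) (tensl n2 a) = 0.
  by rewrite /commmx tensl_tensrC subrr.
have anti_l a a' :
    anticommmx (tensl n2 a) (tensl n2 a') = tensl n2 (anticommmx a a').
  by rewrite /anticommmx !tenslM -linearD.
have anti_r b b' :
    anticommmx (tensr n1 b) (tensr n1 b') = tensr n1 (anticommmx b b').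
  by rewrite /anticommmx !tensrM -linearD.
split.
- by apply/q_odot_qP; exists 0, 0, 0, 0; rewrite !(linear0, addr0).
- move=> c X Y /q_odot_qP[a1 [a1' [b1 [b1' ->]]]].
  move=> /q_odot_qP[a2 [a2' [b2 [b2' ->]]]].
  apply/q_odot_qP; exists (c *: a1 + a2), (c *: a1' + a2').
  exists (c *: b1 + b2), (c *: b1' + b2').
  have -> : tensl n2 (c *: a1 + a2) + tensr n1 (c *: b1 + b2) =
      c *: (tensl n2 a1 + tensr n1 b1) + (tensl n2 a2 + tensr n1 b2).
    by rewrite !linearP /= scalerDr addrACA.
  rewrite (linearP (@tensl C n1 n2)) (linearP (@tensr C n1 n2)) /=.
  rewrite (linearP (emb f 1%:M)) (linearP (emb f (I_U C))).
  rewrite (linearP (emb f (J_U C))) /= !(scalerDr c (_ + _)).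
  rewrite (scalerDr c (E0 _)).
  by rewrite addrACA [X in X + _ = _]addrACA.
- move=> d X /q_odot_qP[a [a' [b [b' ->]]]]; apply/q_odot_qP.
  rewrite -[X in homog d X]addr0 -(linear0 (emb f (P_U C))); case: d.
    exists 0, a', 0, b'.
    by rewrite homog_odd_decomp !linear0 addr0 linear0 add0r.
  exists a, 0, b, 0.
  by rewrite homog_even_decomp !linear0 !addr0.
move=> X Y /q_odot_qP[a1 [a1' [b1 [b1' ->]]]].
move=> /q_odot_qP[a2 [a2' [b2 [b2' ->]]]].
apply/q_odot_qP; exists (commmx a1 a2 - anticommmx a1' a2').
exists (commmx a1 a2' + commmx a1' a2).
exists (commmx b1 b2 - anticommmx b1' b2').
exists (commmx b1 b2' + commmx b1' b2).
rewrite !superbracketDl.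
rewrite !(linearD (superbracket _)) /=.
rewrite !(bracket_E0 _ _ _ (homog_1U C)) !(bracket_E0 _ _ _ (homog_I_U C)).
rewrite !(bracket_E0 _ _ _ (homog_J_U C)) !bracket_IE0 !bracket_JE0.
rewrite bracket_II bracket_JJ bracket_IJ bracket_JI clr crl !linear0.
rewrite anti_l anti_r !commmxDl !(linearD (commmx _)) /= !clr !crl.
rewrite !commmx_tensl !commmx_tensr !(addr0, add0r).
have -> : tensl n2 (commmx a1 a2 - anticommmx a1' a2') +
      tensr n1 (commmx b1 b2 - anticommmx b1' b2') =
    tensl n2 (commmx a1 a2) + tensr n1 (commmx b1 b2) -
    tensl n2 (anticommmx a1' a2') - tensr n1 (anticommmx b1' b2').
  by rewrite !linearB /= addrACA addrA.
rewrite (linearD (@tensl C n1 n2) (commmx a1 _)).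
rewrite (linearD (@tensr C n1 n2) (commmx b1 _)) /=.
rewrite 2!(linearB (emb f 1%:M)) (linearD (emb f (I_U C))).
rewrite (linearD (emb f (J_U C))) /=.
by rewrite [LHS](AC (3*2*2) ((1*5*7)*(2*4)*(3*6))).
Qed.

Lemma odot_proper : (1 < n1 * n2)%N -> (g `<` sl C (tensQ n1 n2))%classic.
Proof.
move=> n12; split=> [X /q_odot_qP[a [a' [b [b' ->]]]]|sub].
  rewrite /sl /= -[X in supertrace X]addr0 -(linear0 (emb f (P_U C))).
  by rewrite supertrace_decomp linear0 mulr0.
pose i0 := Ordinal (ltnW n12); pose i1 := Ordinal n12.
have d0 : (delta_mx i0 i1 : 'M[C]_(n1 * n2)) != 0.
  by apply/eqP=> /matrixP/(_ i0 i1)/eqP; rewrite !mxE !eqxx oner_eq0.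
have /sub/q_odot_qP[a [a' [b [b' E]]]] :
    sl C (tensQ n1 n2) (EP (delta_mx i0 i1)).
  rewrite /sl /=; have := supertrace_decomp 0 0 0 (delta_mx i0 i1).
  rewrite !linear0 !add0r => ->.
  by rewrite /mxtrace big1 ?mulr0 // => i _; rewrite mxE; case: eqP => // ->.
have [|_ _ _ /eqP] := @emb_indep _ _ _ f (tensl n2 a + tensr n1 b)
    (tensl n2 a') (tensr n1 b') (- delta_mx i0 i1).
  by rewrite linearN -E subrr.
by rewrite oppr_eq0 (negPf d0).
Qed.

Section Intermediate.
Variable B : set (gl C (tensQ n1 n2)).
Hypotheses (lieB : lie_subsuperalgebra B) (gB : (g `<=` B)%classic).

Lemma memB_bracket X Y : B X -> B Y -> B (superbracket X Y).
Proof. by case: lieB => _ _ _; apply. Qed.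

Lemma Bsub : linear_subspace B.
Proof. by case: lieB. Qed.

Lemma memB_E0l a : B (E0 (tensl n2 a)).
Proof.
by apply/gB/q_odot_qP; exists a, 0, 0, 0; rewrite !(linear0, addr0).
Qed.

Lemma memB_E0r b : B (E0 (tensr n1 b)).
Proof.
by apply/gB/q_odot_qP; exists 0, 0, b, 0; rewrite !(linear0, addr0, add0r).
Qed.

Lemma memB_EIl a : B (EI (tensl n2 a)).
Proof.
by apply/gB/q_odot_qP; exists 0, a, 0, 0; rewrite !(linear0, addr0, add0r).
Qed.

Lemma memB_EJr b : B (EJ (tensr n1 b)).
Proof.
by apply/gB/q_odot_qP; exists 0, 0, 0, b; rewrite !(linear0, addr0, add0r).
Qed.

Let n2C : 2%:R != 0 :> C. Proof. by rewrite pnatr_eq0. Qed.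

(** Bracket with I and J themselves: both supercommute with R.1, while P
    anticommutes with them. *)
Lemma even_slots x w : B (E0 x + EP w) -> B (EI w) /\ B (EJ w).
Proof.
move=> Bxw; have := memB_bracket (memB_EJr 1%:M) Bxw.
have := memB_bracket (memB_EIl 1%:M) Bxw.
rewrite !linearD /= bracket_IE0 bracket_IP bracket_JE0 bracket_JP.
rewrite tensl1 tensr1 !comm1mx !anticomm1mx !linear0 !add0r !linearZ /=.
move=> /(subspaceZ_inv Bsub n2C)/(subspaceN_inv Bsub) BJ.
by move=> /(subspaceZ_inv Bsub n2C) BI.
Qed.

(** Bracket with I and J again: I supercommutes with R.J and J with R.I, while
    I^2 = J^2 = -1. *)
Lemma odd_slots y z : B (EI y + EJ z) -> B (E0 y) /\ B (E0 z).
Proof.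
move=> Byz; have := memB_bracket (memB_EJr 1%:M) Byz.
have := memB_bracket (memB_EIl 1%:M) Byz.
rewrite !linearD /= bracket_II bracket_IJ bracket_JI bracket_JJ.
rewrite tensl1 tensr1 !comm1mx !anticomm1mx !linear0 !addr0 !add0r.
rewrite !linearZ /=.
move=> /(subspaceZ_inv Bsub n2C)/(subspaceN_inv Bsub) By.
by move=> /(subspaceZ_inv Bsub n2C)/(subspaceN_inv Bsub) Bz.
Qed.

Lemma slots_P w : B (EP w) -> [/\ B (EI w), B (EJ w) & B (E0 w)].
Proof.
move=> Bw; have [|BI BJ] := @even_slots 0 w; first by rewrite linear0 add0r.
split=> //; have [|] // := @odd_slots w 0.
by rewrite linear0 addr0.
Qed.

Lemma slot_subspace m : linear_subspace (fun x => B (emb f m x)).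
Proof.
split=> [|c x y Bx By]; first by rewrite linear0; apply: (subspace0 Bsub).
by rewrite linearP; apply: (subspaceP Bsub).
Qed.

(** [x.I, y.J] = [x, y].P. *)
Lemma P_slot_lie x y : B (EP x) -> B (EP y) -> B (EP (commmx x y)).
Proof.
move=> /slots_P[BI _ _] /slots_P[_ BJ _].
by rewrite -bracket_IJ; apply: memB_bracket.
Qed.

(** Bracketing z.P with b'.J and with b'.1 puts the anticommutator and the
    commutator of b' and z in front of I; their sum is 2b'z.  Then bracket
    (b'z).I with b.J. *)
Lemma P_slot_closedr b b' z : B (EP z) ->
  B (EP (commmx (tensr n1 b) (tensr n1 b' *m z))).
Proof.
move=> Bz; have BI : B (EI (tensr n1 b' *m z)).
  apply: (subspaceZ_inv Bsub n2C).
  rewrite -linearZ -commmx_add_anticommmx linearD /=.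
  apply: (subspaceD Bsub); last first.
    by rewrite -bracket_JP; apply: memB_bracket => //; apply: memB_EJr.
  have [] // := @slots_P (commmx (tensr n1 b') z).
  rewrite -(bracket_E0 _ _ _ (homog_P_U C)).
  by apply: memB_bracket => //; apply: memB_E0r.
apply: (subspaceN_inv Bsub); rewrite -bracket_JI.
by apply: memB_bracket => //; apply: memB_EJr.
Qed.

Lemma P_slot_closedl a a' z : B (EP z) ->
  B (EP (commmx (tensl n2 a) (tensl n2 a' *m z))).
Proof.
move=> Bz; have BJ : B (EJ (tensl n2 a' *m z)).
  apply: (subspaceZ_inv Bsub n2C).
  rewrite -linearZ -commmx_add_anticommmx linearD /=.
  apply: (subspaceD Bsub); last first.
    apply: (subspaceN_inv Bsub); rewrite -bracket_IP.
    by apply: memB_bracket => //; apply: memB_EIl.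
  have [] // := @slots_P (commmx (tensl n2 a') z).
  rewrite -(bracket_E0 _ _ _ (homog_P_U C)).
  by apply: memB_bracket => //; apply: memB_E0l.
by rewrite -bracket_IJ; apply: memB_bracket => //; apply: memB_EIl.
Qed.

(** The hypothesis provides all traceless multiples of P, hence of 1, I and J;
    for these three units g contributes the missing scalar matrices. *)
Lemma sl_sub_of_P_slot z : B (EP z) -> z != 0 ->
  (sl C (tensQ n1 n2) `<=` B)%classic.
Proof.
move=> Bz z0.
have traceless w : \tr w = 0 -> B (EP w).
  apply: (@traceless_generated C n1 n2 (fun x => B (EP x)) z) => //.
  - exact: slot_subspace.
  - exact: P_slot_lie.
  - exact: P_slot_closedl.
  - exact: P_slot_closedr.
have slot m : B (emb f m 1%:M) -> (forall w, B (EP w) -> B (emb f m w)) ->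
    forall x, B (emb f m x).
  move=> B1 BP x.
  have N0 : (n1 * n2)%:R != 0 :> C.
    rewrite pnatr_eq0; apply: contra z0 => /eqP N0.
    apply/eqP/matrixP=> i; have := ltn_ord i.
    by rewrite {2}N0.
  (* Split off the scalar part of x; the rest is traceless. *)
  pose c := \tr x / (n1 * n2)%:R.
  rewrite -(subrK c%:M x) -scalemx1 linearD.
  apply: (subspaceD Bsub); last first.
    by rewrite linearZ; apply: (subspaceZ Bsub).
  apply/BP/traceless; rewrite linearB linearZ /= mxtrace1.
  by rewrite mulfVK // subrr.
move=> X; have [x [y [z' [w ->]]]] := emb_decomp f X.
rewrite /sl /= supertrace_decomp => /eqP.
rewrite mulf_eq0 oppr_eq0 mulf_eq0 (negPf n2C) (negPf (neq0Ci C)) /=.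
move=> /eqP trw.
apply: (subspaceD Bsub); last exact: traceless.
apply: (subspaceD Bsub).
  apply: (subspaceD Bsub); apply: slot => [|v /slots_P[]//].
    by rewrite -(tensl1 C n1 n2); apply: memB_E0l.
  by rewrite -(tensl1 C n1 n2); apply: memB_EIl.
apply: slot => [|v /slots_P[]//].
by rewrite -(tensr1 C n1 n2); apply: memB_EJr.
Qed.

(** With no multiple of P available, every bracket that lands in R.P must
    vanish; the centralizer lemmas turn these vanishing commutators into the
    block form of g.  The trace condition enters to exclude the scalar multiples
    of P, which commute with both factors. *)
Lemma sub_odot_of_P_slot0 : (0 < n1)%N -> (0 < n2)%N ->
  (B `<=` sl C (tensQ n1 n2))%classic -> (forall z, B (EP z) -> z = 0) ->
  (B `<=` g)%classic.
Proof.
move=> n1_gt0 n2_gt0 Bsl P0.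
have even x w : B (E0 x + EP w) -> w = 0.
  move=> Bxw; have [BI BJ] := even_slots Bxw.
  have : is_scalar_mx w.
    apply: centralizer_tensl_tensr => // [a|b]; apply: P0.
      by rewrite -bracket_IJ; apply: memB_bracket => //; apply: memB_EIl.
    apply: (subspaceN_inv Bsub); rewrite -bracket_JI.
    by apply: memB_bracket => //; apply: memB_EJr.
  move=> /is_scalar_mxP[c wc]; rewrite wc.
  have := Bsl _ Bxw; rewrite /sl /=; have := supertrace_decomp x 0 0 w.
  rewrite !linear0 !addr0 => -> /eqP.
  rewrite mulf_eq0 oppr_eq0 mulf_eq0 (negPf n2C) (negPf (neq0Ci C)) /= wc.
  rewrite mxtrace_scalar mulrn_eq0 muln_eq0.
  rewrite (gtn_eqF n1_gt0) (gtn_eqF n2_gt0) /=.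
  by move=> /eqP->; rewrite raddf0.
have even0 x : B (E0 x) -> exists a b, x = tensl n2 a + tensr n1 b.
  move=> Bx; apply: double_centralizer => // a b; apply: P0.
  rewrite -bracket_IJ; apply: memB_bracket; first exact: memB_EIl.
  by rewrite -bracket_JE0; apply: memB_bracket => //; apply: memB_EJr.
have odd y z : B (EI y + EJ z) -> exists a b, y = tensl n2 a /\ z = tensr n1 b.
  move=> Byz.
  have [a ya] : exists a, y = tensl n2 a.
    apply: centralizer_tensr => // b; apply/eqP; rewrite -oppr_eq0; apply/eqP.
    have := memB_bracket (memB_EJr b) Byz.
    rewrite linearD /= bracket_JI bracket_JJ.
    move=> h; apply: (even (- anticommmx (tensr n1 b) z)).
    rewrite (linearN (emb f 1%:M) (anticommmx _ _)).
    by rewrite (linearN (emb f (P_U C)) (commmx _ _)) addrC.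
  have [b zb] : exists b, z = tensr n1 b.
    apply: centralizer_tensl => // a'.
    have := memB_bracket (memB_EIl a') Byz.
    rewrite linearD /= bracket_II bracket_IJ.
    move=> h; apply: (even (- anticommmx (tensl n2 a') y)).
    by rewrite (linearN (emb f 1%:M) (anticommmx _ _)).
  by exists a, b.
move=> X BX; have [x [y [z [w XE]]]] := emb_decomp f X.
have [_ _ Bh _] := lieB.
have Bev : B (E0 x + EP w).
  by rewrite -(homog_even_decomp f x y z w) -XE; apply: Bh.
have Bodd : B (EI y + EJ z).
  by rewrite -(homog_odd_decomp f x y z w) -XE; apply: Bh.
have w0 := even _ _ Bev.
move: Bev; rewrite w0 linear0 addr0 => /even0[a [b xE]].
have [a' [b' [yE zE]]] := odd _ _ Bodd.
by apply/q_odot_qP; exists a, a', b, b'; rewrite XE w0 linear0 addr0 xE yE zE.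
Qed.

End Intermediate.
End Odot.

(** * Maximality *)

Theorem theorem2p3p1 (R : realType) (n1 n2 : nat) (hn : (1 < n1 * n2)%N) :
  maximal_subsuperalgebra (sl R[i] (tensQ n1 n2)) (q_odot_q R[i] n1 n2).
Proof.
have /andP[n1_gt0 n2_gt0] : (0 < n1)%N && (0 < n2)%N.
  by rewrite -muln_gt0 ltnW.
split; [exact: odot_lie_subsuperalgebra | exact: odot_proper |].
move=> B lieB [gB Bg] [Bsl slB]; apply: Bg.
apply: sub_odot_of_P_slot0 => // z Bz.
have [//|z0] := eqVneq z 0; case: slB.
exact: (sl_sub_of_P_slot lieB gB Bz z0).
Qed.
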